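(* Let $A$ be a finite set and let $\Gamma_1$ be a valued constraint language on $A$, i.e. a finite set of functions $\varrho:A^k\to[0,1]$ (with $k$ depending on $\varrho$). For each $\varrho\in\Gamma_1$ of arity $k$ let $R_\varrho=\{\mathbf a\in A^k \mid \varrho(\mathbf a)=0\}$, and let $\Gamma_2=\{R_\varrho \mid \varrho\in\Gamma_1\}$. Then $\mathrm{VCSP}(\Gamma_1)$ belongs to $\mathrm{APX}$ if and only if $\mathrm{MinCSP}(\Gamma_2)$ belongs to $\mathrm{APX}$.
   Context: An instance of $\mathrm{VCSP}(\Gamma_1)$ consists of a finite set $V$ of variables and a finite list of constraints $C=(\mathbf v,\varrho)$ where $\varrho\in\Gamma_1$ is $k$-ary, $\mathbf v\in V^k$, each with a weight $w_C\in\mathbb Q_{>0}$; the goal is to find an assignment $s:V\to A$ minimizing $\sum_C w_C\,\varrho(s(\mathbf v))$ ($s$ applied componentwise). For a constraint language $\Gamma$ (finite set of relations on $A$), an instance of $\mathrm{MinCSP}(\Gamma)$ consists of a finite set $V$ of variables and a finite list of weighted constraints $C=(\mathbf v,R)$ with $R\in\Gamma$ of arity $k$, $\mathbf v\in V^k$, $w_C\in\mathbb Q_{>0}$; the goal is to find $s:V\to A$ minimizing the total weight of constraints with $s(\mathbf v)\notin R$. A problem is in $\mathrm{APX}$ if it admits a polynomial-time constant-factor approximation algorithm, i.e. one that for some constant $c$ always returns an assignment of value at most $c$ times the optimum. *)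

(* Defs.v *)
From HB Require Import structures.
From Corelib Require Import PosDef.
From mathcomp Require Import all_boot all_order all_algebra finmap reals.

Set Implicit Arguments.
Unset Strict Implicit.
Unset Printing Implicit Defensive.

Import Order.TTheory GRing.Theory Num.Theory.
Local Open Scope fset_scope.
Local Open Scope ring_scope.

Variant move := MoveL | MoveR | Stay.

(* Tape cells hold [None] (the blank), an input/output symbol [inl a], or an
   auxiliary work symbol [inr b]. *)
Record machine (Sigma : finType) := Machine {
  state : finType;
  work : finType;
  start : state;
  halted : pred state;
  delta : state -> option (Sigma + work) ->
          state * option (Sigma + work) * move }.

Section Run.
Variables (Sigma : finType) (M : machine Sigma).

Definition cell := option (Sigma + work M).

(* [left] is the part of the tape strictly to the left of the head, nearest
   cell first; [right] starts with the scanned cell.  Cells beyond either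
   sequence are blank. *)
Record config := Config { cstate : state M; left : seq cell; right : seq cell }.

Definition init (x : seq Sigma) : config :=
  Config (start M) [::] [seq Some (inl a) | a <- x].

Definition step (c : config) : config :=
  if halted (cstate c) then c else
  let: (q, b, d) := delta (cstate c) (head None (right c)) in
  let r := behead (right c) in
  match d with
  | MoveL => Config q (behead (left c)) (head None (left c) :: b :: r)
  | MoveR => Config q (b :: left c) r
  | Stay => Config q (left c) (b :: r)
  end.

(* The output is the longest word over [Sigma] that starts at the head. *)
Fixpoint read (t : seq cell) : seq Sigma :=
  if t is Some (inl a) :: t' then a :: read t' else [::].

(* [step] fixes halted configurations, so this says that [M] halts on [x]
   after at most [t] steps, with output [y]. *)
Definition outputs_within (t : nat) (x y : seq Sigma) : Prop :=
  let c := iter t step (init x) in halted (cstate c) /\ read (right c) = y.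

End Run.

Record min_problem (R : realType) := MinProblem {
  alphabet : finType;
  instance : Type;
  solution : instance -> Type;
  encode_instance : instance -> seq alphabet;
  encode_solution : forall I, solution I -> seq alphabet;
  value : forall I, solution I -> R }.

Definition optimal (R : realType) (P : min_problem R) (I : instance P)
    (s : solution I) : Prop :=
  forall s' : solution I, value s <= value s'.

Definition APX (R : realType) (P : min_problem R) : Prop :=
  exists (M : machine (alphabet P)) (p : {poly nat}) (c : R),
  forall I : instance P, exists s : solution I,
    outputs_within M p.[size (encode_instance I)]
      (encode_instance I) (encode_solution s) /\
    forall s_opt : solution I, optimal s_opt -> value s <= c * value s_opt.

(* The first component is the arity. *)
Definition relation (A : finType) := {k : nat & {set k.-tuple A}}.
Definition cost_function (R : realType) (A : finType) :=
  {k : nat & {ffun k.-tuple A -> R}}.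

HB.instance Definition _ (A : finType) := Choice.on (relation A).
HB.instance Definition _ (R : realType) (A : finType) :=
  Choice.on (cost_function R A).

Definition is_valued_language (R : realType) (A : finType)
    (G : {fset cost_function R A}) : Prop :=
  forall f, f \in G -> forall a : (tag f).-tuple A, 0 <= tagged f a <= 1.

Definition zero_relation (R : realType) (A : finType)
    (f : cost_function R A) : relation A :=
  Tagged (fun k => {set k.-tuple A})
         [set a : (tag f).-tuple A | tagged f a == 0].

Definition zero_language (R : realType) (A : finType)
    (G : {fset cost_function R A}) : {fset relation A} :=
  [fset zero_relation f | f in G].

Record wconstraint (S : finType) (ar : S -> nat) (n : nat) := WConstraint {
  symbol : S;
  scope : (ar symbol).-tuple 'I_n;
  weight : rat;
  weight_gt0 : 0 < weight }.

Record csp_instance (S : finType) (ar : S -> nat) := CspInstance {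
  nvars : nat;
  constraints : seq (wconstraint ar nvars) }.

Definition assignment (S A : finType) (ar : S -> nat) (I : csp_instance ar) :=
  {ffun 'I_(nvars I) -> A}.

Inductive letter (S A : Type) :=
  Symbol of S | Value of A | Bit of bool | Tick | Sep | Slash.
Arguments Tick {S A}.
Arguments Sep {S A}.
Arguments Slash {S A}.
Arguments Symbol {S A}.
Arguments Value {S A}.
Arguments Bit {S A}.

Section LetterFinite.
Variables S A : Type.
Definition letter_code (l : letter S A) : S + A + bool + option bool :=
  match l with
  | Symbol f => inl (inl (inl f)) | Value a => inl (inl (inr a))
  | Bit b => inl (inr b)
  | Tick => inr None | Sep => inr (Some false) | Slash => inr (Some true)
  end.
Definition letter_decode (c : S + A + bool + option bool) : letter S A :=
  match c with
  | inl (inl (inl f)) => Symbol f | inl (inl (inr a)) => Value a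
  | inl (inr b) => Bit b
  | inr None => Tick | inr (Some false) => Sep | inr (Some true) => Slash
  end.
Lemma letter_codeK : cancel letter_code letter_decode.
Proof. by case. Qed.
End LetterFinite.

HB.instance Definition _ (S A : finType) :=
  Finite.copy (letter S A) (can_type (@letter_codeK S A)).

Section Encoding.
Variables S A : finType.

(* Binary notation, least significant bit first; 0 is the empty word. *)
Fixpoint pos_bits (p : positive) : seq bool :=
  match p with
  | xH => [:: true]
  | xO p' => false :: pos_bits p'
  | xI p' => true :: pos_bits p'
  end.
Definition nat_bits (n : nat) : seq (letter S A) :=
  if bin_of_nat n is Npos p then [seq Bit b | b <- pos_bits p] else [::].

Variable ar : S -> nat.

Definition encode_constraint n (C : wconstraint ar n) : seq (letter S A) :=
  Symbol (symbol C)
    :: flatten [seq Sep :: nat_bits (i : 'I_n) | i <- scope C]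
    ++ Sep :: nat_bits `|numq (weight C)|%N
    ++ Slash :: nat_bits `|denq (weight C)|%N.

(* One [Tick] per variable, then the constraints; only the names of the
   variables and the weights are in binary, so the size is at least |V|. *)
Definition encode_csp (I : csp_instance ar) : seq (letter S A) :=
  nseq (nvars I) Tick
    ++ flatten [seq encode_constraint C | C <- constraints I].

Definition encode_assignment (I : csp_instance ar) (s : assignment A I) :
    seq (letter S A) :=
  [seq Value (s i) | i <- enum 'I_(nvars I)].

End Encoding.

Section Problems.
Variables (R : realType) (A : finType).

Section VCSP.
Variable G : {fset cost_function R A}.
Definition cost_arity (f : G) : nat := tag (val f).

Definition vcsp_value (I : csp_instance cost_arity) (s : assignment A I) : R :=
  \sum_(C <- constraints I)
    ratr (weight C) * tagged (val (symbol C)) (map_tuple s (scope C)).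

Definition VCSP : min_problem R :=
  MinProblem (@encode_csp G A cost_arity) (@encode_assignment G A cost_arity)
    vcsp_value.
End VCSP.

Section MinCSP.
Variable G : {fset relation A}.
Definition rel_arity (r : G) : nat := tag (val r).

Definition mincsp_value (I : csp_instance rel_arity) (s : assignment A I) : R :=
  \sum_(C <- constraints I |
        map_tuple s (scope C) \notin tagged (val (symbol C)))
    ratr (weight C).

Definition MinCSP : min_problem R :=
  MinProblem (@encode_csp G A rel_arity) (@encode_assignment G A rel_arity)
    mincsp_value.
End MinCSP.

End Problems.

(* Main.v *)
Require Import Defs.
From mathcomp Require Import all_boot all_order all_algebra finmap boolp reals.

(** Let [e > 0] be the least nonzero value taken by a cost function of the
    language.  Replacing each cost function by the indicator of its nonzero
    locus changes the value of an assignment by a factor between [1] and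
    [e^-1], so the two problems have the same approximate solutions up to a
    constant.  In both directions the translation of instances renames the
    constraint symbols one letter at a time, so a Turing machine for one problem
    yields a machine for the other that renames the letters as it scans them,
    with no overhead in time. *)

Set Implicit Arguments.
Unset Strict Implicit.
Unset Printing Implicit Defensive.

Import Order.TTheory GRing.Theory Num.Theory.
Local Open Scope ring_scope.

Definition singleton_fiber (T U : Type) (f : T -> U) (x : T) : Prop :=
  forall y, f y = f x -> y = x.

Section PreimageMachine.
Variables (Sigma1 Sigma2 : finType) (phi : Sigma1 -> Sigma2).
Variable M : machine Sigma2.

(* The letters that [phi] misses become work symbols. *)
Definition preimage_cell : finType :=
  option (Sigma1 + ({b : Sigma2 | b \notin codom phi} + work M)).

Definition decode_cell (c : preimage_cell) : cell M :=
  match c with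
  | None => None
  | Some (inl a) => Some (inl (phi a))
  | Some (inr (inl b)) => Some (inl (val b))
  | Some (inr (inr w)) => Some (inr w)
  end.

Lemma codom_decode_cell (c : cell M) : c \in codom decode_cell.
Proof.
case: c => [[b|w]|]; last exact: (codom_f decode_cell None).
  have [/codomP[a ->]|b_missed] := boolP (b \in codom phi).
    exact: (codom_f decode_cell (Some (inl a))).
  exact: (codom_f decode_cell (Some (inr (inl (Sub b b_missed))))).
exact: (codom_f decode_cell (Some (inr (inr w)))).
Qed.

Definition encode_cell (c : cell M) : preimage_cell :=
  iinv (codom_decode_cell c).

Lemma encode_cellK : cancel encode_cell decode_cell.
Proof. by move=> c; apply: f_iinv. Qed.

Definition preimage_machine : machine Sigma1 :=
  @Machine Sigma1 (state M) _ (start M) (@halted _ M)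
    (fun q c => let: (q', b, d) := delta q (decode_cell c) in
                (q', encode_cell b, d)).

Definition decode_config (c : config preimage_machine) : config M :=
  @Config _ M (cstate c) (map decode_cell (left c)) (map decode_cell (right c)).

Lemma decode_init (x : seq Sigma1) :
  decode_config (init preimage_machine x) = init M (map phi x).
Proof. by rewrite /decode_config /init /= -!map_comp. Qed.

Lemma head_decode_cell (t : seq (cell preimage_machine)) :
  head None (map decode_cell t) = decode_cell (head None t).
Proof. by case: t. Qed.

Lemma decode_step : {morph decode_config : c / step c}.
Proof.
move=> c; rewrite /step /=; case: ifP => // _.
rewrite head_decode_cell; case: delta => [[q b] []] /=;
  by rewrite /decode_config /= ?head_decode_cell ?encode_cellK ?behead_map.
Qed.

Lemma decode_cell_letter (a : Sigma1) (c : preimage_cell) :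
    singleton_fiber phi a ->
  decode_cell c = Some (inl (phi a)) -> c = Some (inl a).
Proof.
move=> fiber_phi; case: c => [[b|[[b /= b_missed]|w]]|] //= [].
  by move/fiber_phi->.
by move=> def_b; case/negP: b_missed; rewrite def_b codom_f.
Qed.

Lemma read_decode_cell (t : seq (cell preimage_machine)) (y : seq Sigma1) :
    {in y, forall a, singleton_fiber phi a} ->
  read (map decode_cell t) = map phi y -> read t = y.
Proof.
elim: t y => [|c t IHt] [|a y] //= fiber_phi; first by case: c => [[]|].
case def_c: (decode_cell c) => [[b|w]|] //= [eq_b eq_t].
rewrite eq_b in def_c.
rewrite (decode_cell_letter (fiber_phi a (mem_head a y)) def_c) (IHt y) //.
by move=> a' y_a'; apply: fiber_phi; rewrite inE y_a' orbT.
Qed.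

Lemma preimage_outputs_within (n : nat) (x y : seq Sigma1) :
    {in y, forall a, singleton_fiber phi a} ->
  outputs_within M n (map phi x) (map phi y) ->
  outputs_within preimage_machine n x y.
Proof.
move=> fiber_phi; rewrite /outputs_within -decode_init.
have iter_decode c : iter n (@step _ M) (decode_config c) =
    decode_config (iter n (@step _ preimage_machine) c).
  by elim: n => //= n ->; rewrite decode_step.
by rewrite iter_decode => -[halts /(read_decode_cell fiber_phi)].
Qed.

End PreimageMachine.

Section LetterwiseReduction.
Variables (R : realType) (P Q : min_problem R).
Variables (phi : alphabet P -> alphabet Q) (f : instance P -> instance Q).
Variable pull : forall I : instance P, solution (f I) -> solution I.
Variable push : forall I : instance P, solution I -> solution (f I).
Variables a b : R.
Hypothesis encode_f : forall I,
  encode_instance (f I) = map phi (encode_instance I).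
Hypothesis encode_pull : forall I (t : solution (f I)),
  encode_solution t = map phi (encode_solution (pull t)).
Hypothesis fiber_solution : forall I (s : solution I),
  {in encode_solution s, forall l, singleton_fiber phi l}.
Hypothesis optimum : forall I, solution (f I) ->
  exists t : solution (f I), optimal t.
Hypothesis a_ge0 : 0 <= a.
Hypothesis value_ge0 : forall I (t : solution (f I)), 0 <= value t.
Hypothesis value_pull : forall I (t : solution (f I)),
  value (pull t) <= a * value t.
Hypothesis value_push : forall I (s : solution I),
  value (push s) <= b * value s.

Lemma APX_letterwise_reduction : APX Q -> APX P.
Proof.
move=> [M [p [c approx]]].
(* [APX] does not require [c] to be nonnegative. *)
exists (preimage_machine phi M), p, (a * (`|c| * b)) => I.
have [t [out_t t_le]] := approx (f I); exists (pull t); split.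
  apply: preimage_outputs_within; first exact: fiber_solution.
  by move: out_t; rewrite encode_f encode_pull size_map.
move=> s _; have [t_opt t_optP] := optimum t.
rewrite -!mulrA; apply: le_trans (value_pull t) _; apply: ler_wpM2l => //.
apply: le_trans (t_le _ t_optP) _.
apply: le_trans (ler_wpM2r (value_ge0 _) (ler_norm c)) _.
by apply: ler_wpM2l => //; apply: le_trans (t_optP _) (value_push s).
Qed.

End LetterwiseReduction.

Section WeightedCsp.
Variables (R : realType) (A S : finType) (ar : S -> nat).
Implicit Types cost : forall f : S, (ar f).-tuple A -> R.

Definition weighted_cost cost (I : csp_instance ar) (s : assignment A I) : R :=
  \sum_(C <- constraints I)
    ratr (weight C) * cost (symbol C) (map_tuple s (scope C)).

Definition weighted_csp cost : min_problem R :=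
  MinProblem (@encode_csp S A ar) (@encode_assignment S A ar)
    (weighted_cost cost).

Lemma ratr_weight_ge0 n (C : wconstraint ar n) : 0 <= ratr (weight C) :> R.
Proof. by rewrite ler0q ltW ?weight_gt0. Qed.

Lemma weighted_cost_ge0 cost (I : csp_instance ar) (s : assignment A I) :
  (forall f t, 0 <= cost f t) -> 0 <= weighted_cost cost s.
Proof.
by move=> cost_ge0; apply: sumr_ge0 => C _; rewrite mulr_ge0 ?ratr_weight_ge0.
Qed.

Lemma ler_weighted_cost cost1 cost2 (a : R) (I : csp_instance ar)
    (s : assignment A I) :
    (forall f t, cost1 f t <= a * cost2 f t) ->
  weighted_cost cost1 s <= a * weighted_cost cost2 s.
Proof.
move=> le_cost; rewrite /weighted_cost mulr_sumr; apply: ler_sum => C _.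
by rewrite mulrCA ler_wpM2l ?ratr_weight_ge0.
Qed.

Lemma exists_optimal_assignment cost (I : csp_instance ar) :
    assignment A I ->
  exists s : assignment A I, @optimal R (weighted_csp cost) I s.
Proof.
move=> s0; exists [arg min_(s < s0) weighted_cost cost s]%O => s.
by case: arg_minP => //= s1 _; apply.
Qed.

End WeightedCsp.

Lemma map_tcast (T U : Type) (g : T -> U) m n (e : m = n) (t : m.-tuple T) :
  map_tuple g (tcast e t) = tcast e (map_tuple g t).
Proof. by case: n / e. Qed.

Section Relabel.
Variables (R : realType) (A S1 S2 : finType).
Variables (ar1 : S1 -> nat) (ar2 : S2 -> nat).
Variables (phi : S1 -> S2) (ar_phi : forall f, ar1 f = ar2 (phi f)).

Definition relabel_constraint n (C : wconstraint ar1 n) : wconstraint ar2 n :=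
  @WConstraint S2 ar2 n (phi (symbol C)) (tcast (ar_phi _) (scope C))
    (weight C) (weight_gt0 C).

Definition relabel (I : csp_instance ar1) : csp_instance ar2 :=
  CspInstance (map (@relabel_constraint (nvars I)) (constraints I)).

Definition relabel_letter (l : letter S1 A) : letter S2 A :=
  match l with
  | Symbol f => Symbol (phi f)
  | Value a => Value a | Bit b => Bit b
  | Tick => Tick | Sep => Sep | Slash => Slash
  end.

Lemma relabel_letter_nat_bits n :
  map relabel_letter (nat_bits S1 A n) = nat_bits S2 A n.
Proof. by rewrite /nat_bits; case: bin_of_nat => //= p; rewrite -map_comp. Qed.

Lemma encode_relabel_constraint n (C : wconstraint ar1 n) :
  encode_constraint A (relabel_constraint C) =
    map relabel_letter (encode_constraint A C).
Proof.
rewrite /encode_constraint /= !map_cat map_flatten /= map_cat /=.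
rewrite !relabel_letter_nat_bits val_tcast -map_comp.
congr (_ :: flatten _ ++ _); apply: eq_map => i /=.
by rewrite relabel_letter_nat_bits.
Qed.

Lemma encode_relabel (I : csp_instance ar1) :
  encode_csp A (relabel I) = map relabel_letter (encode_csp A I).
Proof.
rewrite /encode_csp map_cat map_nseq map_flatten -!map_comp.
by congr (_ ++ flatten _); apply: eq_map => C; apply: encode_relabel_constraint.
Qed.

Lemma encode_assignment_relabel (I : csp_instance ar1) (s : assignment A I) :
  @encode_assignment S2 A ar2 (relabel I) s =
    map relabel_letter (encode_assignment s).
Proof. by rewrite /encode_assignment -map_comp. Qed.

Lemma singleton_fiber_relabel_letter (I : csp_instance ar1)
    (s : assignment A I) :
  {in encode_assignment s, forall l, singleton_fiber relabel_letter l}.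
Proof. by move=> _ /mapP[i _ ->] [] //= a [->]. Qed.

Lemma weighted_cost_relabel (cost : forall f, (ar2 f).-tuple A -> R)
    (I : csp_instance ar1) (s : assignment A I) :
  @weighted_cost R A S2 ar2 cost (relabel I) s =
    weighted_cost (fun f t => cost (phi f) (tcast (ar_phi f) t)) s.
Proof.
rewrite /weighted_cost big_map; apply: eq_bigr => C _.
by rewrite /= map_tcast.
Qed.

Lemma APX_relabel (cost1 : forall f, (ar1 f).-tuple A -> R)
    (cost2 : forall f, (ar2 f).-tuple A -> R) (a b : R) :
    0 <= a -> (forall f t, 0 <= cost2 f t) ->
    (forall f t, cost1 f t <= a * cost2 (phi f) (tcast (ar_phi f) t)) ->
    (forall f t, cost2 (phi f) (tcast (ar_phi f) t) <= b * cost1 f t) ->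
  APX (weighted_csp cost2) -> APX (weighted_csp cost1).
Proof.
move=> a_ge0 cost2_ge0 cost1_le cost2_le.
apply: (@APX_letterwise_reduction R (weighted_csp cost1) (weighted_csp cost2)
  relabel_letter relabel (fun _ s => s) (fun _ s => s) a b) => //=.
- exact: encode_relabel.
- exact: encode_assignment_relabel.
- exact: singleton_fiber_relabel_letter.
- by move=> I; apply: exists_optimal_assignment.
- by move=> I s; apply: weighted_cost_ge0.
- by move=> I s; rewrite weighted_cost_relabel; apply: ler_weighted_cost.
- by move=> I s; rewrite weighted_cost_relabel; apply: ler_weighted_cost.
Qed.

End Relabel.

Section WithinFactors.
Variables (R : realType) (A : finType).
Implicit Types f g : cost_function R A.

Definition within_factors (a b : R) f g : Prop :=
  exists e : tag f = tag g, forall t : (tag f).-tuple A,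
    tagged f t <= a * tagged g (tcast e t) /\
    tagged g (tcast e t) <= b * tagged f t.

Lemma within_factors_sym (a b : R) f g :
  within_factors a b f g -> within_factors b a g f.
Proof.
case: f g => [k f] [k' g] [/= e]; case: k' / e g => g bounds.
by exists erefl => t; have [] := bounds t.
Qed.

Lemma APX_within_factors (S1 S2 : finType) (F1 : S1 -> cost_function R A)
    (F2 : S2 -> cost_function R A) (phi : S1 -> S2) (a b : R) :
    0 <= a -> (forall j (t : (tag (F2 j)).-tuple A), 0 <= tagged (F2 j) t) ->
    (forall i, within_factors a b (F1 i) (F2 (phi i))) ->
  APX (weighted_csp (fun j => tagged (F2 j))) ->
  APX (weighted_csp (fun i => tagged (F1 i))).
Proof.
move=> a_ge0 F2_ge0 F12.
have ar_phi i : tag (F1 i) = tag (F2 (phi i)) by have [] := F12 i.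
have bounds i (t : (tag (F1 i)).-tuple A) :
    tagged (F1 i) t <= a * tagged (F2 (phi i)) (tcast (ar_phi i) t) /\
    tagged (F2 (phi i)) (tcast (ar_phi i) t) <= b * tagged (F1 i) t.
  by have [e] := F12 i; rewrite (eq_irrelevance (ar_phi i) e).
by apply: (APX_relabel (ar_phi := ar_phi) (b := b) a_ge0) => // i t;
  have [] := bounds i t.
Qed.

End WithinFactors.

Lemma positive_values_bounded_below (R : realDomainType) (T : finType)
    (F : T -> R) :
  exists2 e : R, 0 < e & forall x, 0 < F x -> e <= F x.
Proof.
exists (\big[Num.min/1]_(x | 0 < F x) F x).
  by elim/big_ind: _ => // x y x_gt0 y_gt0; rewrite lt_min x_gt0.
by move=> x Fx_gt0; apply: bigmin_le_cond.
Qed.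

Section ZeroLanguage.
Variables (R : realType) (A : finType).

Definition violation (r : relation A) : cost_function R A :=
  Tagged (fun k => {ffun k.-tuple A -> R})
    [ffun t : (tag r).-tuple A => (t \notin tagged r)%:R].

Lemma violation_ge0 (r : relation A) (t : (tag r).-tuple A) :
  0 <= tagged (violation r) t.
Proof. by rewrite ffunE ler0n. Qed.

Lemma MinCSP_weighted_csp (G : {fset relation A}) :
  MinCSP R G = weighted_csp (fun r : G => tagged (violation (val r))).
Proof.
congr MinProblem; apply: functional_extensionality_dep => I; apply/funext => s.
rewrite /mincsp_value big_mkcond; apply: eq_bigr => C _.
by rewrite ffunE; case: ifP; rewrite ?mulr1 ?mulr0.
Qed.

Variable G : {fset cost_function R A}.

Lemma within_factors_violation_zero_relation : is_valued_language G ->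
  exists2 b : R, 0 <= b & forall f : G,
    within_factors 1 b (val f) (violation (zero_relation (val f))).
Proof.
move=> G_valued; pose F (x : {f : G & (cost_arity f).-tuple A}) : R :=
  tagged (val (tag x)) (tagged x).
have [e e_gt0 e_le] := positive_values_bounded_below F.
exists e^-1 => [|f]; first by rewrite invr_ge0 ltW.
exists erefl => t; rewrite tcast_id ffunE inE mul1r ler_pdivlMl //.
have /andP[ft_ge0 ft_le1] := G_valued _ (valP f) t.
have [->|ft_neq0] := eqVneq (tagged (val f) t) 0; first by rewrite mulr0 lexx.
have := e_le (Tagged (fun f : G => (cost_arity f).-tuple A) t).
by rewrite /F /= mulr1 lt0r ft_neq0 ft_ge0 => ->.
Qed.

Definition to_zero_language (f : G) : zero_language G :=
  [` in_imfset _ (@zero_relation R A) (valP f)]%fset.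

Lemma to_zero_language_surj (r : zero_language G) :
  exists f : G, to_zero_language f = r.
Proof.
have /imfsetP[f /= fG def_r] := valP r.
by exists [` fG]%fset; apply: val_inj.
Qed.

End ZeroLanguage.

Theorem theorem4 (R : realType) (A : finType)
    (Gamma1 : {fset cost_function R A})
    (hGamma1 : is_valued_language Gamma1) :
  APX (VCSP Gamma1) <-> APX (MinCSP R (zero_language Gamma1)).
Proof.
have [b b_ge0 near_violation] := within_factors_violation_zero_relation hGamma1.
rewrite MinCSP_weighted_csp; split.
- have [rep repK] := choice (@to_zero_language_surj R A Gamma1).
  apply: (APX_within_factors (F2 := val) (phi := rep) b_ge0) => [f t|r].
    by have /andP[] := hGamma1 _ (valP f) t.
  by rewrite -{1}(repK r); apply/within_factors_sym/near_violation.
- apply: (APX_within_factors (F1 := val) (phi := @to_zero_language R A Gamma1)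
    ler01 _ near_violation) => r t; exact: violation_ge0.
Qed.
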